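(* Consider the system $$x(t+1)=Fx(t)+F_1(t)x(t)+F_2(t),\qquad t\in\mathbb Z^+,$$ where $x(t)\in\mathbb R^n$, $F\in\mathbb R^{n\times n}$ is Schur, and $F_1(t)\in\mathbb R^{n\times n}$, $F_2(t)\in\mathbb R^n$ are well defined for all $t\in\mathbb Z^+$. If $F_1(t)\to0$ and $F_2(t)\to0$ as $t\to\infty$, then for any $x(0)\in\mathbb R^n$, $x(t)\to0$ as $t\to\infty$. If moreover $F_1(t)\to0$ and $F_2(t)\to0$ exponentially as $t\to\infty$, then for any $x(0)\in\mathbb R^n$, $x(t)\to0$ exponentially as $t\to\infty$.
   Context: $\mathbb Z^+$ is the set of nonnegative integers. A square matrix is Schur if all its eigenvalues have modulus less than $1$. A sequence $y(t)$ tends to $0$ exponentially if there are constants $c>0$ and $0<\alpha<1$ with $\|y(t)\|\le c\,\alpha^t$ for all $t\in\mathbb Z^+$ (the constants may depend on the trajectory). *)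

(* Defs.v *)
From mathcomp Require Import all_boot all_order all_algebra.
From mathcomp Require Import all_classical all_reals all_analysis.
From mathcomp Require Import complex.
Import Order.TTheory GRing.Theory Num.Theory.
Import numFieldNormedType.Exports.

Set Implicit Arguments.
Unset Strict Implicit.
Unset Printing Implicit Defensive.

Local Open Scope ring_scope.
Local Open Scope classical_set_scope.
Local Open Scope complex_scope.

(* The eigenvalues of a real matrix are those of its complexification.
   [eigenvalue] refers to row eigenvectors, which give the same spectrum as
   column eigenvectors. *)
Definition schur (R : realType) (n : nat) (F : 'M[R]_n) : Prop :=
  forall l : R[i], eigenvalue (map_mx (real_complex R) F) l -> `|l| < 1.

(* On matrices [`| |] is the entrywise sup norm; since all norms are equivalent
   in finite dimension, another norm would only change the constant [c]. *)
Definition exp_to0 (R : realType) (V : normedModType R) (y : nat -> V) : Prop :=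
  exists c alpha : R, [/\ 0 < c, 0 < alpha, alpha < 1 &
    forall t : nat, `|y t| <= c * alpha ^+ t].

(* Main.v *)
(* By Cayley-Hamilton the powers of a Schur matrix F decay geometrically, say
   |F^k| <= c r^k with r < 1. For r < q < 1 and N large, the norm
   V x = sum_(k <= N) q^-k |F^k x| satisfies V (F x) <= q V x, so v t = V (x t)
   obeys v (t+1) <= (q + a t) v t + b t, with a and b proportional to |F1| and
   |F2|. Once a t <= (1 - q)/2, this is a scalar contraction forced by b. *)
Require Import Defs.
From mathcomp Require Import all_boot all_order all_algebra.
From mathcomp Require Import all_classical all_reals all_analysis.
From mathcomp Require Import complex ring lra.
Import Order.TTheory GRing.Theory Num.Theory.
Import numFieldNormedType.Exports.

Local Open Scope ring_scope.
Local Open Scope classical_set_scope.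

(** * Geometric recursions and the entrywise norm *)

Lemma geometric_bound (K : numFieldType) (u : nat -> K) (q r c : K) :
  0 <= q -> q < r -> 0 <= c -> 0 <= u 0%N ->
  (forall k, u k.+1 <= q * u k + c * r ^+ k) ->
  exists2 C, 0 <= C & forall k, u k <= C * r ^+ k.
Proof.
move=> q0 qr c0 u0 hu; have rq : 0 < r - q by rewrite subr_gt0.
have r0 : 0 <= r by apply: le_trans (ltW qr).
have cq0 : 0 <= c / (r - q) by rewrite divr_ge0 // ltW.
(* [c / (r - q) * r ^+ k] solves the recursion with equality; adding [u 0] covers the initial
   value. *)
exists (u 0%N + c / (r - q)); first by rewrite addr_ge0.
elim=> [|k IH]; first by rewrite expr0 mulr1 lerDl.
apply: (le_trans (hu k)); apply: (le_trans (lerD (ler_wpM2l q0 IH) (lexx _))).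
rewrite mulrA -mulrDl exprS mulrA ler_wpM2r ?exprn_ge0 //.
rewrite -subr_ge0.
have -> : (u 0%N + c / (r - q)) * r - (q * (u 0%N + c / (r - q)) + c) =
  (r - q) * u 0%N by field; rewrite gt_eqF.
by rewrite mulr_ge0 // ltW.
Qed.

Lemma le_mx_norm_entry (K : numFieldType) (m n : nat) (A : 'M[K]_(m, n)) i j :
  `|A i j| <= `|A|.
Proof.
rewrite [leRHS]/Num.norm /= mx_normE -[leLHS]nngE num_le.
exact: (le_bigmax _ (fun ij => `|A ij.1 ij.2|%:nng) (i, j)).
Qed.

Lemma mx_norm_le (R : realType) (m n : nat) (A : 'M[R]_(m, n)) (c : R) :
  0 <= c -> (forall i j, `|A i j| <= c) -> `|A| <= c.
Proof.
move=> c0 h; rewrite [leLHS]/Num.norm /= mx_normrE.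
by apply/bigmax_leP; split => // -[i j] _ /=.
Qed.

Lemma mx_norm_mul (R : realType) (m n p : nat) (A : 'M[R]_(m, n))
    (B : 'M[R]_(n, p)) : `|A *m B| <= n%:R * `|A| * `|B|.
Proof.
apply: mx_norm_le => [|i j]; first by rewrite !mulr_ge0.
rewrite mxE; apply: (le_trans (ler_norm_sum _ _ _)).
apply: (@le_trans _ _ (\sum_(k < n) `|A| * `|B|)); last first.
  by rewrite sumr_const card_ord -mulrA mulr_natl.
by apply: ler_sum => k _; rewrite normrM ler_pM // le_mx_norm_entry.
Qed.

(** * Geometric decay of the powers of a Schur matrix *)

(* If B p(A) = 0 with p = prod_l (X - l), then y_k = B A^k satisfies
   y_{k+1} = l y_k + B (A - l) A^k, and B (A - l) is annihilated by the
   remaining factors, so one induction on the list of roots suffices. *)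
Lemma annihilated_powers_bound (K : numFieldType) (n : nat) (A : 'M[K]_n.+1)
    (r : K) (s : seq K) :
  all (fun l => `|l| < r) s ->
  forall B : 'M[K]_n.+1,
    B * horner_mx A (\prod_(l <- s) ('X - l%:P)) = 0 ->
    exists2 c, 0 <= c & forall k, `|B * A ^+ k| <= c * r ^+ k.
Proof.
elim: s => [_ B|l s IH /= /andP[lr sr] B].
  rewrite big_nil rmorph1 mulr1 => ->; exists 0 => // k.
  by rewrite !mul0r normr0.
rewrite big_cons rmorphM mulrA => /(IH sr)[c c0 hc].
apply: (@geometric_bound K (fun k => `|B * A ^+ k|) `|l| r c) => // k.
rewrite -normrZ; apply: le_trans (lerD (lexx _) (hc k)).
apply: le_trans (ler_normD _ _); rewrite le_eqVlt; apply/orP; left; apply/eqP.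
congr (`| _ |); rewrite rmorphB /= horner_mx_X horner_mx_C.
rewrite mulrBr mulrBl -mulrA -exprS.
by rewrite [B * l%:M]mul_mx_scalar -scalerAl addrC subrK.
Qed.

(** A finite spectrum inside the open unit disc leaves a gap. The radius is taken real because the
    decay rate must return to the real matrix. *)
Lemma uniform_bound_lt1 (R : realType) (s : seq R[i]) :
  all (fun l => `|l| < 1) s ->
  exists r : R, [/\ 0 < r, r < 1 & all (fun l => `|l| < (r%:C)%C) s].
Proof.
elim: s => [_|l s IH /= /andP[l1 /IH[r [r0 r1 hr]]]].
  by exists (2^-1); split=> //; lra.
rewrite normc_def ltcR in l1 *.
set z := Num.sqrt _ in l1 *.
(* The midpoint of [z] and 1 lies strictly above the modulus [z] of the new root. *)
exists (Num.max r ((1 + z) / 2)); split; first by rewrite lt_max r0.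
  by rewrite gt_max r1 /=; lra.
rewrite ltcR lt_max; apply/andP; split; first by apply/orP; right; lra.
apply/allP => w ws; apply: lt_le_trans (allP hr w ws) _.
by rewrite lecR le_max lexx.
Qed.

Lemma schur_powers_bound (R : realType) (n : nat) (F : 'M[R]_n.+1) :
  schur F ->
  exists c r : R, [/\ 0 <= c, 0 < r, r < 1 & forall k, `|F ^+ k| <= c * r ^+ k].
Proof.
move=> hF; pose A := map_mx (real_complex R) F.
have [s hs] := closed_field_poly_normal (char_poly A).
rewrite (monicP (char_poly_monic A)) scale1r in hs.
have s1 : all (fun l => `|l| < 1) s.
  apply/allP => l ls; apply: hF.
  by rewrite eigenvalue_root_char -/A hs root_prod_XsubC.
have [r [r0 r1 hr]] := uniform_bound_lt1 _ _ s1.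
have [|c c0 hc] := @annihilated_powers_bound _ _ A _ _ hr 1.
  by rewrite -hs Cayley_Hamilton mulr0.
(* A nonnegative element of [R[i]] is real, so the bound descends to [R] without loss. *)
have cE : c = ((complex.Re c)%:C)%C by rewrite RRe_real // ger0_real.
rewrite cE -[0]/((0%:C)%C) lecR in c0; rewrite cE in hc.
exists (complex.Re c), r; split=> // k.
apply: mx_norm_le => [|i j]; first by rewrite mulr_ge0 // exprn_ge0 // ltW.
have := le_trans (le_mx_norm_entry _ _ _ _ i j) (hc k).
have -> : (1 * A ^+ k) i j = ((F ^+ k) i j)%:C%C.
  by rewrite mul1r -[A ^+ k]rmorphXn mxE.
by rewrite normc_def /= expr0n /= addr0 sqrtr_sqr -rmorphXn -rmorphM lecR.
Qed.

(** Acting on vectors lets dimension 0, where every vector is zero, join the bound on powers. *)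
Lemma schur_iter_bound (R : realType) (n : nat) (F : 'M[R]_n) :
  schur F ->
  exists c r : R, [/\ 0 <= c, 0 < r, r < 1 &
    forall k (x : 'cV[R]_n), `|iter k (mulmx F) x| <= c * r ^+ k * `|x|].
Proof.
case: n F => [F _|n F /schur_powers_bound[c [r [c0 r0 r1 hr]]]].
  exists 0, 2^-1; split; [by []|lra|lra|] => k x.
  by rewrite flatmx0 normr0 !mul0r.
exists (n.+1%:R * c), r; split=> //; first by rewrite mulr_ge0.
move=> k x.
have -> : iter k (mulmx F) x = F ^+ k *m x.
  elim: k => [|k IH] /=; first by rewrite expr0 mul1mx.
  by rewrite IH exprS mulmxA.
apply: (le_trans (mx_norm_mul _ _ _ _ _ _)).
by rewrite ler_wpM2r // -mulrA ler_wpM2l.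
Qed.

(** * A norm contracted by [F] *)

Lemma geometric_small (R : realType) (c r e : R) :
  0 <= r -> r < 1 -> 0 < e ->
  exists N, forall t, (N <= t)%N -> c * r ^+ t <= e.
Proof.
move=> r0 r1 e0.
have hc : (fun t => c * r ^+ t) @ \oo --> (0 : R).
  rewrite -[X in _ --> X](mulr0 c); apply: cvgMr; apply: cvg_expr.
  by rewrite ger0_norm.
have /cvgr0Pnorm_le/(_ e e0)[N _ hN] := hc.
by exists N => t Nt; apply: le_trans (ler_norm _) (hN t Nt).
Qed.

(** In [|F^k| <= c r^k] the constant may exceed 1, so one step need not contract the original norm.
    A norm contracted at every step lets the perturbations be estimated one step at a time. *)
Lemma schur_contracting_norm (R : realType) (n : nat) (F : 'M[R]_n) :
  schur F ->
  exists (V : 'cV[R]_n -> R) (M q : R),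
    [/\ 0 <= M, 0 < q, q < 1,
        (forall x, `|x| <= V x /\ V x <= M * `|x|) &
        (forall x y, V (x + y) <= V x + V y) /\
        (forall x, V (F *m x) <= q * V x)].
Proof.
move=> /schur_iter_bound[c [r [c0 r0 r1 hr]]].
pose q := (1 + r) / 2.
have [q0 q1 rq] : [/\ 0 < q, q < 1 & r < q] by rewrite /q; split; lra.
have [N hN] : exists N, c * (r / q) ^+ N.+1 <= 1.
  have [||N hN] := @geometric_small R c (r / q) 1 _ _ ltr01.
  - by rewrite divr_ge0 // ltW.
  - by rewrite ltr_pdivrMr // mul1r.
  by exists N; apply: hN.
have qX k : 0 < q ^+ k by rewrite exprn_gt0.
(* This bound is what allows the sum defining [V] to stop at [N]. *)
have hFN (x : 'cV[R]_n) : `|iter N.+1 (mulmx F) x| <= q ^+ N.+1 * `|x|.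
  apply: (le_trans (hr _ _)); rewrite ler_wpM2r //.
  by rewrite expr_div_n mulrA ler_pdivrMr // mul1r in hN.
pose V (x : 'cV[R]_n) := \sum_(k < N.+1) q ^- k * `|iter k (mulmx F) x|.
exists V, (\sum_(k < N.+1) q ^- k * (c * r ^+ k)), q; split=> //.
- apply: sumr_ge0 => k _.
  by rewrite !mulr_ge0 // ?invr_ge0 ?exprn_ge0 // ltW.
- move=> x; split.
    rewrite /V big_ord_recl expr0 invr1 mul1r lerDl sumr_ge0 // => k _.
    by rewrite mulr_ge0 // invr_ge0 ltW.
  rewrite mulr_suml; apply: ler_sum => k _.
  by rewrite -mulrA ler_wpM2l // invr_ge0 ltW.
split=> [x y|x].
  rewrite -big_split; apply: ler_sum => k _ /=.
  rewrite -mulrDr ler_wpM2l ?invr_ge0 ?(ltW (qX _)) //.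
  have -> : iter k (mulmx F) (x + y) = iter k (mulmx F) x + iter k (mulmx F) y.
    by elim: (nat_of_ord k) => //= j ->; rewrite mulmxDr.
  exact: ler_normD.
have iterF k (y : 'cV[R]_n) : iter k (mulmx F) (F *m y) = iter k.+1 (mulmx F) y.
  by rewrite iterSr.
(* Applying [F] shifts the sum: each term [k < N] becomes [q] times term [k + 1], and the top term
   is absorbed by [q * |x|], that is, [q] times term 0. *)
rewrite /V big_ord_recr [in leRHS]big_ord_recl /= expr0 invr1 mul1r mulrDr.
rewrite mulr_sumr addrC lerD //.
  rewrite iterF ler_pdivrMl // mulrA -exprSr; exact: hFN.
apply: ler_sum => k _; rewrite iterF mulrA ler_wpM2r //.
by rewrite /bump /= add1n exprS invfM mulVKf // gt_eqF.
Qed.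

(** * Scalar comparison *)

Section Comparison.
Variables (R : realType) (v a b : nat -> R) (q : R).
Hypotheses (q0 : 0 < q) (q1 : q < 1) (v0 : forall t, 0 <= v t).
Hypothesis a_small : forall e, 0 < e ->
  exists N, forall t, (N <= t)%N -> a t <= e.
Hypothesis v_rec : forall t, v t.+1 <= (q + a t) * v t + b t.

Let q' := (1 + q) / 2.

Let v_rec_eventually :
  exists T, forall t, (T <= t)%N -> v t.+1 <= q' * v t + b t.
Proof.
have [|T hT] := a_small ((1 - q) / 2); first by move: q1; lra.
exists T => t Tt; apply: (le_trans (v_rec t)); rewrite lerD2r ler_wpM2r //.
by rewrite /q'; have := hT t Tt; lra.
Qed.

Lemma comparison_small :
  (forall e, 0 < e -> exists N, forall t, (N <= t)%N -> b t <= e) ->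
  forall e, 0 < e -> exists N, forall t, (N <= t)%N -> v t <= e.
Proof.
move=> b_small e e0; have [T hT] := v_rec_eventually.
have [q'0 q'1] : 0 < q' /\ q' < 1 by rewrite /q'; split; move: q0 q1; lra.
(* Under a constant forcing [d] the recursion has fixed point [d / (1 - q')], here [e / 2]; the
   other half of [e] is left for the transient. *)
have [|T' hT'] := b_small (e / 2 * (1 - q')).
  by rewrite mulr_gt0 ?divr_gt0 // subr_gt0.
pose S := maxn T T'.
have hv k : v (S + k)%N <= e / 2 + v S * q' ^+ k.
  elim: k => [|k IH]; first by rewrite addn0 expr0 mulr1; lra.
  rewrite addnS exprS.
  have TS : (T <= S + k)%N by rewrite (leq_trans (leq_maxl T T')) // leq_addr.
  have TS' : (T' <= S + k)%N by rewrite (leq_trans (leq_maxr T T')) // leq_addr.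
  have h1 := hT _ TS; have h2 := hT' _ TS'.
  have h3 := ler_wpM2l (ltW q'0) IH.
  by move: (q' ^+ k) h1 h2 h3 => p; lra.
have [|N hN] := @geometric_small R (v S) q' (e / 2) (ltW q'0) q'1.
  by rewrite divr_gt0.
exists (S + N)%N => t St.
have SN : (S <= t)%N by apply: leq_trans (leq_addr _ _) St.
have := hv (t - S)%N; have := hN (t - S)%N.
rewrite subnKC // leq_subRL // => /(_ St); lra.
Qed.

Lemma comparison_exponential (c r : R) :
  0 <= c -> 0 < r -> r < 1 -> (forall t, b t <= c * r ^+ t) ->
  exists C s, [/\ 0 < C, 0 < s, s < 1 & forall t, v t <= C * s ^+ t].
Proof.
move=> c0 r0 r1 hb; have [T hT] := v_rec_eventually.
have [q'0 q'1] : 0 < q' /\ q' < 1 by rewrite /q'; split; move: q0 q1; lra.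
(* The rate must strictly exceed [q'] for [geometric_bound], and dominate [r] so that the forcing is
   at most [c * s ^+ k]. *)
pose s := (1 + Num.max q' r) / 2.
have [qs rs s1] : [/\ q' < s, r < s & s < 1].
  have : Num.max q' r < 1 by rewrite gt_max q'1.
  have : q' <= Num.max q' r by rewrite le_max lexx.
  have : r <= Num.max q' r by rewrite le_max lexx orbT.
  by rewrite /s; move: (Num.max _ _) => m; split; lra.
have s0 : 0 < s by apply: lt_trans rs.
have [|C C0 hC] := @geometric_bound R (fun k => v (T + k)%N) q' s c
  (ltW q'0) qs c0 (v0 _).
  move=> k; rewrite addnS; apply: (le_trans (hT _ (leq_addr _ _))).
  rewrite lerD2l; apply: (le_trans (hb _)); rewrite ler_wpM2l //.
  apply: (@le_trans _ _ (r ^+ k)); last first.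
    by rewrite lerXn2r ?nnegrE // ltW.
  by rewrite exprD ler_piMl ?exprn_ile1 ?exprn_ge0 // ltW.
have sX k : 0 < s ^+ k by rewrite exprn_gt0.
(* [D] dominates each ratio [v k / s ^+ k] before time [T], where the contraction is not yet
   available. *)
pose D := \sum_(k < T) v k / s ^+ k.
have D0 : 0 <= D by apply: sumr_ge0 => k _; rewrite divr_ge0 // ltW.
have CT0 : 0 <= C / s ^+ T by rewrite divr_ge0 // ltW.
(* Dividing by [s ^+ T] undoes the time shift in [hC]; the summand 1 makes the constant strictly
   positive. *)
exists (1 + C / s ^+ T + D), s; split=> //; first by move: D0 CT0; lra.
move=> t; rewrite -ler_pdivrMr //; have [tT|Tt] := ltnP t T.
  have : v t / s ^+ t <= D.
    rewrite /D (bigD1 (Ordinal tT)) //= lerDl sumr_ge0 // => k _.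
    by rewrite divr_ge0 // ltW.
  by move: D0 CT0; lra.
have : v t / s ^+ t <= C / s ^+ T.
  have := hC (t - T)%N; rewrite subnKC // ler_pdivrMr //.
  by rewrite -[X in _ / _ * s ^+ X](subnKC Tt) exprD mulrA divfK // gt_eqF.
by move: D0 CT0; lra.
Qed.

End Comparison.

(** * Transfer to the perturbed system *)

Lemma exp_to0_cvg (R : realType) (V : normedModType R) (y : nat -> V) :
  exp_to0 y -> y @ \oo --> (0 : V).
Proof.
move=> [c [r [c0 r0 r1 hy]]]; apply/cvgr0Pnorm_le => e e0.
have [N hN] := @geometric_small R c r e (ltW r0) r1 e0.
by exists N => // t Nt; apply: le_trans (hy t) (hN t Nt).
Qed.

Lemma cvg0_scaled_norm_small (R : realType) (V : normedModType R) (y : nat -> V)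
    (m e : R) :
  0 <= m -> y @ \oo --> (0 : V) -> 0 < e ->
  exists N, forall t, (N <= t)%N -> m * `|y t| <= e.
Proof.
move=> m0 /cvgr0Pnorm_le hy e0.
have m1 : 0 < m + 1 by move: m0; lra.
(* Dividing by [m + 1] also covers [m = 0]. *)
have [|N _ hN] := hy (e / (m + 1)); first by rewrite divr_gt0.
exists N => t /hN /=; rewrite ler_pdivlMr // mulrC => h.
by apply: le_trans h; rewrite ler_wpM2r //; lra.
Qed.

Theorem lemma1 (R : realType) (n : nat) (F : 'M[R]_n)
    (F1 : nat -> 'M[R]_n) (F2 : nat -> 'cV[R]_n) (hF : schur F) :
  (F1 @ \oo --> (0 : 'M[R]_n) -> F2 @ \oo --> (0 : 'cV[R]_n) ->
    forall x : nat -> 'cV[R]_n,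
      (forall t : nat, x t.+1 = F *m x t + F1 t *m x t + F2 t) ->
      x @ \oo --> (0 : 'cV[R]_n)) /\
  (exp_to0 F1 -> exp_to0 F2 ->
    forall x : nat -> 'cV[R]_n,
      (forall t : nat, x t.+1 = F *m x t + F1 t *m x t + F2 t) ->
      exp_to0 x).
Proof.
have [V [M [q [M0 q0 q1 hV [VD VF]]]]] := schur_contracting_norm _ _ _ hF.
have V0 y : 0 <= V y by apply: le_trans (hV y).1.
have Mn0 : 0 <= M * n%:R by rewrite mulr_ge0.
(* The perturbation is measured in the sup norm and returned to [V] by [|x| <= V x]; the factor [n]
   comes from the sup norm of a product. *)
have V_rec (x : nat -> 'cV[R]_n) :
    (forall t, x t.+1 = F *m x t + F1 t *m x t + F2 t) ->
    forall t, V (x t.+1) <= (q + M * n%:R * `|F1 t|) * V (x t) + M * `|F2 t|.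
  move=> hx t; rewrite hx; apply: (le_trans (VD _ _)).
  apply: lerD; last exact: (hV _).2.
  apply: (le_trans (VD _ _)); rewrite mulrDl; apply: lerD; first exact: VF.
  apply: (le_trans (hV _).2); rewrite -!mulrA ler_wpM2l //.
  apply: (le_trans (mx_norm_mul _ _ _ _ _ _)).
  by rewrite -mulrA !ler_wpM2l // (hV _).1.
split=> [hF1 hF2 x /V_rec hx|hF1 [c [r [c0 r0 r1 hF2]]] x /V_rec hx].
  apply/cvgr0Pnorm_le => e e0.
  have [|||N hN] := comparison_small _ _ _ _ _ q0 q1 _ _ hx _ e e0.
  - by move=> t; apply: V0.
  - by move=> d; apply: cvg0_scaled_norm_small.
  - by move=> d; apply: cvg0_scaled_norm_small.
  by exists N => // t Nt /=; apply: le_trans (hV _).1 (hN t Nt).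
have [||||C [s [C0 s0 s1 hC]]] := comparison_exponential _ _ _ _ _ q0 q1 _ _ hx
  (M * c) r _ r0 r1.
- by move=> t; apply: V0.
- by move=> d; apply: cvg0_scaled_norm_small => //; apply: exp_to0_cvg.
- by rewrite mulr_ge0 // ltW.
- by move=> t; rewrite -mulrA ler_wpM2l.
by exists C, s; split=> // t; apply: le_trans (hV _).1 (hC t).
Qed.
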